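(* For all integers $d\ge1$ and $r\ge1$ there is a real number $C$ such that for every integer $n\ge1$, every $d$-dimensional simplicial complex having $n$ vertices and not containing a subcomplex homeomorphic to $[r]^{*(d+1)}$ contains less than $Cn^{d+1-r^{1-d}}$ simplices of dimension $d$.
   Context: $[r]=\{1,\ldots,r\}$ is regarded as a 0-dimensional simplicial complex with $r$ points, and $[r]^{*(d+1)}=[r]*\cdots*[r]$ is the join of $d+1$ copies of it. Explicitly, it is the $d$-dimensional simplicial complex with vertex set $\{1,\ldots,d+1\}\times[r]$ whose simplices are the nonempty vertex subsets containing at most one vertex from each $\{i\}\times[r]$; for instance $[r]^{*2}=K_{r,r}$. A subcomplex is homeomorphic to $[r]^{*(d+1)}$ if their geometric realizations are homeomorphic. *)

(* Defs.v *)
From HB Require Import structures.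
From mathcomp Require Import all_boot all_order all_algebra.
From mathcomp Require Import all_classical all_reals all_analysis.

Set Implicit Arguments.
Unset Strict Implicit.
Unset Printing Implicit Defensive.

Import Order.TTheory GRing.Theory Num.Theory.
Import numFieldNormedType.Exports.

Local Open Scope ring_scope.

(* A finite abstract simplicial complex is given by its set of (nonempty)
   simplices.  Points of the ambient type V need not be vertices. *)
Definition simplicial_complex (V : finType) (K : {set {set V}}) : Prop :=
  finset.set0 \notin K /\
  forall s t : {set V},
    s \in K -> t \subset s -> t != finset.set0 -> t \in K.

Definition vertices (V : finType) (K : {set {set V}}) : {set V} :=
  [set v | [set v]%SET \in K]%SET.

Definition simplices_of_dim (V : finType) (k : nat) (K : {set {set V}}) :
    {set {set V}} :=
  [set s in K | #|s| == k.+1]%SET.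

Definition has_dim (V : finType) (d : nat) (K : {set {set V}}) : Prop :=
  (forall s, s \in K -> (#|s| <= d.+1)%N) /\
  exists s, s \in simplices_of_dim d K.

Definition subcomplex (V : finType) (L K : {set {set V}}) : Prop :=
  simplicial_complex L /\ L \subset K.

(* Barycentric coordinates: functions V -> R with the product topology. *)
Definition realization (R : realType) (V : finType) (K : {set {set V}}) :
    set {ptws V -> R} :=
  [set x : V -> R | [/\ forall v, 0 <= x v, \sum_v x v = 1
                      & [set v | x v != 0]%SET \in K]]%classic.

Arguments realization R {V} K.

Definition realization_space (R : realType) (V : finType) (K : {set {set V}}) :
    topologicalType :=
  set_type (realization R K).

Arguments realization_space R {V} K.

Definition homeomorphic (X Y : topologicalType) : Prop :=
  exists (f : X -> Y) (g : Y -> X),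
    [/\ cancel f g, cancel g f, continuous f & continuous g].

(* The join of k copies of the 0-dimensional complex on r points. *)
Definition join_power (k r : nat) : {set {set 'I_k * 'I_r}} :=
  [set s | (s != finset.set0) &&
           [forall i, (#|[set p in s | p.1 == i]%SET| <= 1)%N]]%SET.

Lemma join_power_complex (k r : nat) : simplicial_complex (join_power k r).
Proof.
split=> [|s t]; first by rewrite inE eqxx.
rewrite !inE => /andP[_ /forallP sP] ts -> /=; apply/forallP => i.
apply: leq_trans (sP i); apply: subset_leq_card; apply/fintype.subsetP => p.
by rewrite !inE => /andP[/(fintype.subsetP ts) -> ->].
Qed.

(* Main.v *)
(* Let e = r^(1-d).  As long as a (k+1)-uniform family on n points has at least
   c n^(k+1-e) members, with c large and e <= 1, convexity of x |-> x^r gives an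
   r-set A whose common link contains at least (c-r) n^(k-re) faces of size k.
   Iterating d-1 times, the exponent deficit becomes r^(d-1) e = 1, so some
   iterated common link is a graph with more than C n edges.  By Mader's theorem
   it contains a subdivision of K_{r,r}.  Joining this subdivision with the r-sets
   found on the way yields a subcomplex, which is obtained from [r]^{*(d+1)} by
   successively subdividing edges; each such step is a homeomorphism. *)

Require Import Defs.
From HB Require Import structures.
From mathcomp Require Import all_boot all_order all_algebra.
From mathcomp Require Import all_classical all_reals all_analysis.
From mathcomp Require Import fintype finset.
From mathcomp Require Import zify lra.

Set Implicit Arguments.
Unset Strict Implicit.
Unset Printing Implicit Defensive.

Import Order.TTheory GRing.Theory Num.Theory.
Import numFieldNormedType.Exports.

Local Open Scope ring_scope.

(** * Homeomorphisms of realizations *)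

(** For r >= 2 a graph with linearly many edges need not contain K_{r,r}, so counting alone could
    not go as far as deficit 1; accepting a homeomorphic copy is what makes that deficit reachable
    and so decides the exponent. The price is that the subdivision is found in a link and has to be
    transported to the join. It is therefore recorded combinatorially, as a chain of edge
    subdivisions: that joining respects such a chain is a statement about faces only, and topology
    enters just once, for a single edge. Each link step lowers the leading constant by r, because
    r-subsets are counted by falling factorials and not by powers; hence C is the density required
    for K_{r,r} plus (d - 1) r. *)

Lemma homeomorphic_refl (X : topologicalType) : homeomorphic X X.
Proof. by exists id, id; split=> // x; exact: cvg_id. Qed.

Lemma homeomorphic_sym (X Y : topologicalType) :
  homeomorphic X Y -> homeomorphic Y X.
Proof. by case=> f [g [fK gK cf cg]]; exists g, f. Qed.

Lemma homeomorphic_trans (X Y Z : topologicalType) :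
  homeomorphic X Y -> homeomorphic Y Z -> homeomorphic X Z.
Proof.
move=> [f [f' [fK f'K cf cf']]] [g [g' [gK g'K cg cg']]].
exists (g \o f), (f' \o g'); split.
- exact: can_comp.
- exact: can_comp.
- by move=> x; apply: continuous_comp; [exact: cf | exact: cg].
- by move=> x; apply: continuous_comp; [exact: cg' | exact: cf'].
Qed.

(** The realization is a subspace of a product, so continuity is tested on coordinates; taking [f]
    on all of [V -> R] keeps the subspace out of that test. *)
Lemma continuous_realization (R : realType) (V V' : finType)
    (F : {set {set V}}) (F' : {set {set V'}}) (f : (V -> R) -> V' -> R)
    (h : realization_space R F -> realization_space R F') :
  (forall x, set_val (h x) = f (set_val x)) ->
  (forall v, continuous (fun x : {ptws V -> R} => f x v)) ->
  continuous h.
Proof.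
move=> hf cf.
have c1 : continuous (set_val \o h : realization_space R F -> {ptws V' -> R}).
  move=> x; have FF : Filter ((set_val \o h) x @[x --> x])%classic.
    by apply: fmap_filter; exact: nbhs_filter.
  apply/cvg_sup => v.
  apply: (@continuous_comp_initial _ (realization_space R F) R
            (fun y : V' -> R => y v) (set_val \o h)).
  have -> : ((fun y : V' -> R => y v) \o (set_val \o h)) =
            ((fun x : {ptws V -> R} => f x v) \o set_val).
    by apply: funext => z /=; rewrite hf.
  move=> z; apply: continuous_comp; last exact: cf.
  exact: initial_continuous.
exact: (@continuous_comp_initial _ (realization_space R F) {ptws V' -> R}).
Qed.

Lemma homeomorphic_realization (R : realType) (V V' : finType)
    (F : {set {set V}}) (F' : {set {set V'}})
    (f : (V -> R) -> V' -> R) (g : (V' -> R) -> V -> R) :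
  (forall x, realization R F x -> realization R F' (f x)) ->
  (forall y, realization R F' y -> realization R F (g y)) ->
  (forall x, realization R F x -> g (f x) = x) ->
  (forall y, realization R F' y -> f (g y) = y) ->
  (forall v, continuous (fun x : {ptws V -> R} => f x v)) ->
  (forall v, continuous (fun y : {ptws V' -> R} => g y v)) ->
  homeomorphic (realization_space R F) (realization_space R F').
Proof.
move=> fP gP fK gK cf cg.
pose f1 (x : realization_space R F) : realization_space R F' :=
  SigSub (mem_set (fP _ (set_mem (valP x)))).
pose g1 (y : realization_space R F') : realization_space R F :=
  SigSub (mem_set (gP _ (set_mem (valP y)))).
exists f1, g1; split.
- by move=> x; apply: val_inj; rewrite /= fK //; exact: set_mem (valP x).
- by move=> y; apply: val_inj; rewrite /= gK //; exact: set_mem (valP y).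
- exact: (@continuous_realization _ _ _ _ _ f).
- exact: (@continuous_realization _ _ _ _ _ g).
Qed.

(* Subdivision of the edge uv by a new vertex w.  Families of faces here and below
   usually contain the empty face, which the realization does not see. *)
Definition stellar (V : finType) (u v w : V) (F : {set {set V}}) :
    {set {set V}} :=
  [set s : {set V} | ~~ ([set u; v] \subset s) &&
     (if w \in s then (s :\ w) :|: [set u; v] \in F else s \in F)].

(* Both the subdivision homeomorphism and its inverse move a point in the direction
   (u + v)/2 - w, by the amounts -2 min(x_u, x_v) and x_w respectively. *)
Definition push_dir (R : realType) (V : finType) (u v w z : V) : R :=
  (z == u)%:R / 2 + (z == v)%:R / 2 - (z == w)%:R.

Definition push (R : realType) (V : finType) (u v w : V) (c : (V -> R) -> R)
    (x : V -> R) : V -> R :=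
  fun z => x z + c x * push_dir R u v w z.

Lemma sum_push (R : realType) (V : finType) (u v w : V) c (x : V -> R) :
  \sum_z push u v w c x z = \sum_z x z.
Proof.
have s1 (a : V) : \sum_z (z == a)%:R = 1 :> R.
  by rewrite (bigD1 a) //= eqxx big1 ?addr0 // => i /negPf ->.
rewrite big_split /= -mulr_sumr; have -> : \sum_i push_dir R u v w i = 0; last first.
  by rewrite mulr0 addr0.
rewrite sumrB big_split /= -!mulr_suml !s1; lra.
Qed.

Lemma pushK (R : realType) (V : finType) (u v w : V) c c' (x : V -> R) :
  c' (push u v w c x) = - c x -> push u v w c' (push u v w c x) = x.
Proof.
move=> cc; apply: funext => z.
rewrite -[LHS]/(push u v w c x z + c' (push u v w c x) * push_dir R u v w z).
by rewrite cc mulNr /push addrK.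
Qed.

Lemma continuous_addMr (R : realType) (T : topologicalType) (f c : T -> R) k :
  continuous f -> continuous c -> continuous (fun x => f x + c x * k).
Proof.
move=> cf cc x; apply: cvgD; first exact: cf.
by apply: cvgM; [exact: cc | exact: cvg_cst].
Qed.

Lemma continuous_push (R : realType) (V : finType) (u v w : V) c (z : V) :
  continuous (c : {ptws V -> R} -> R) ->
  continuous (fun x : {ptws V -> R} => push u v w c x z).
Proof.
exact: (@continuous_addMr R {ptws V -> R} (fun x => x z) c
          (push_dir R u v w z) (@proj_continuous V (fun=> R) z)).
Qed.

Lemma continuous_minM (R : realType) (T : topologicalType) (f g : T -> R) (k : R) :
  continuous f -> continuous g ->
  continuous (fun x => - (k * Order.min (f x) (g x))).
Proof.
move=> cf cg x; apply: cvgN; apply: cvgM; first exact: cvg_cst.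
by apply: (@continuous_min R T f g x); [exact: cf | exact: cg].
Qed.

(** Removing the minimum of x_u and x_v from both makes one of them vanish, so the edge uv leaves
    the support, and w receives twice this minimum. Conversely one of y_u, y_v is 0, so after adding
    y_w / 2 to both their minimum is y_w / 2, which recovers the amount moved. *)
Lemma homeomorphic_stellar (R : realType) (V : finType) (u v w : V)
    (F : {set {set V}}) :
  u != v -> u != w -> v != w -> (forall s, s \in F -> w \notin s) ->
  homeomorphic (realization_space R F) (realization_space R (stellar u v w F)).
Proof.
move=> uv uw vw Fw.
pose m (x : V -> R) := Order.min (x u) (x v).
pose c1 x := - (2 * m x); pose c2 (x : V -> R) := x w.
have du : push_dir R u v w u = 1 / 2 by rewrite /push_dir eqxx (negPf uv) (negPf uw) /=; lra.
have dv : push_dir R u v w v = 1 / 2.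
  by rewrite /push_dir eqxx eq_sym (negPf uv) (negPf vw) /=; lra.
have dw : push_dir R u v w w = - 1.
  by rewrite /push_dir eqxx 2!(eq_sym w) (negPf uw) (negPf vw) /=; lra.
have dz z : z != u -> z != v -> z != w -> push_dir R u v w z = 0.
  by rewrite /push_dir => /negPf -> /negPf -> /negPf -> /=; lra.
have casez (P : V -> Prop) : P u -> P v -> P w ->
    (forall z, z != u -> z != v -> z != w -> P z) -> forall z, P z.
  move=> Pu Pv Pw Pz z; have [->//|zu] := eqVneq z u.
  by have [->//|zv] := eqVneq z v; have [->//|zw] := eqVneq z w; exact: Pz.
have xw x : realization R F x -> x w = 0.
  move=> [_ _ /Fw]; rewrite inE negbK => /eqP //.
have m0 x : (forall z, 0 <= x z) -> [/\ 0 <= m x, m x <= x u & m x <= x v].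
  by move=> x0; rewrite /m le_min !x0 ge_min lexx ge_min lexx orbT.
have mE x : (x u = m x) \/ (x v = m x).
  by rewrite /m; case: leP; [left|right].
have pm y : realization R (stellar u v w F) y -> (y u = 0) \/ (y v = 0).
  move=> [y0 _]; rewrite inE => /andP[+ _]; rewrite subUset !sub1set !inE.
  by rewrite negb_and !negbK => /orP[/eqP|/eqP]; [left|right].
have push0 c (x : V -> R) : c x = 0 -> push u v w c x = x.
  by move=> c0; apply: funext => z; rewrite /push c0 mul0r addr0.
apply: (@homeomorphic_realization R _ _ _ _ (push u v w c1) (push u v w c2)).
- move=> x rx; have [x0 xs xF] := rx; have [mx0 mxu mxv] := m0 _ x0.
  have x'w := xw _ rx.
  have pu : push u v w c1 x u = x u - m x by rewrite /push du /c1; lra.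
  have pv : push u v w c1 x v = x v - m x by rewrite /push dv /c1; lra.
  have pw : push u v w c1 x w = 2 * m x by rewrite /push dw /c1 x'w; lra.
  have pz z : z != u -> z != v -> z != w -> push u v w c1 x z = x z.
    by move=> zu zv zw; rewrite /push dz // mulr0 addr0.
  split; [|by rewrite sum_push|].
    apply: casez; [rewrite pu; lra|rewrite pv; lra|rewrite pw; lra|].
    by move=> z zu zv zw; rewrite pz.
  rewrite inE; apply/andP; split.
    rewrite subUset !sub1set !inE pu pv !subr_eq0 negb_and !negbK.
    by case: (mE x) => <-; rewrite eqxx ?orbT.
  (* If the minimum is 0, the point does not move. Otherwise w is in the new support, and trading it
     for u and v gives back the support of x. *)
  rewrite inE pw; have [mx|mxn] := eqVneq (m x) 0.
    by rewrite mx mulr0 eqxx /= push0 // /c1 mx mulr0 oppr0.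
  rewrite mulf_neq0 ?pnatr_eq0 //.
  rewrite (_ : _ :|: _ = [set v0 | x v0 != 0]) //; apply/setP => z; move: z.
  have mp : 0 < m x by rewrite lt_def mxn.
  apply: casez; last by move=> z zu zv zw; rewrite !inE zw (negPf zu) (negPf zv) pz //= orbF.
  + by rewrite !inE eqxx ?orbT /=; apply/esym/eqP; lra.
  + by rewrite !inE eqxx ?orbT /=; apply/esym/eqP; lra.
  + by rewrite !inE eqxx (eq_sym w u) (eq_sym w v) (negPf uw) (negPf vw) x'w eqxx.
- move=> y ry; have [y0 ys yF] := ry; have yuv := pm _ ry.
  have pu : push u v w c2 y u = y u + y w / 2 by rewrite /push du /c2; lra.
  have pv : push u v w c2 y v = y v + y w / 2 by rewrite /push dv /c2; lra.
  have pw : push u v w c2 y w = 0 by rewrite /push dw /c2; lra.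
  have pz z : z != u -> z != v -> z != w -> push u v w c2 y z = y z.
    by move=> zu zv zw; rewrite /push dz // mulr0 addr0.
  have yu := y0 u; have yv := y0 v; have yw := y0 w.
  split; [|by rewrite sum_push|].
    apply: casez; [rewrite pu; lra|rewrite pv; lra|rewrite pw; lra|].
    by move=> z zu zv zw; rewrite pz.
  move: yF; rewrite inE => /andP[_]; rewrite inE.
  have [yw0|ywn] := eqVneq (y w) 0; first by rewrite push0.
  move=> /=; rewrite (_ : _ :|: _ = [set v0 | push u v w c2 y v0 != 0]) //.
  apply/setP => z; move: z.
  have yp : 0 < y w by rewrite lt_def ywn.
  apply: casez; last by move=> z zu zv zw; rewrite !inE zw (negPf zu) (negPf zv) pz //= orbF.
  + by rewrite !inE eqxx ?orbT /=; apply/esym/eqP; lra.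
  + by rewrite !inE eqxx ?orbT /=; apply/esym/eqP; lra.
  + by rewrite !inE eqxx (eq_sym w u) (eq_sym w v) (negPf uw) (negPf vw) pw eqxx.
- by move=> x rx; apply: pushK; rewrite /c2 /push dw (xw _ rx); lra.
- move=> y ry; apply: pushK.
  have [y0 _ _] := ry; have yu := y0 u; have yv := y0 v; have yw := y0 w.
  rewrite /c1 /m /push du dv /c2.
  by case: leP => h; case: (pm _ ry) => h'; rewrite h' in h *; lra.
- move=> z; apply: continuous_push.
  exact: (@continuous_minM R {ptws V -> R} (fun x => x u) (fun x => x v) 2
    (@proj_continuous V (fun=> R) u) (@proj_continuous V (fun=> R) v)).
- by move=> z; apply: continuous_push => x; exact: (@proj_continuous V (fun=> R) w).
Qed.

(** Extension by zero and restriction along [phi] are inverse to each other. This compares a join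
    built on indices with one made of subsets of V. *)
Lemma homeomorphic_imset (R : realType) (T V : finType) (phi : T -> V)
    (F : {set {set T}}) :
  injective phi ->
  homeomorphic (realization_space R F)
    (realization_space R ((fun s : {set T} => phi @: s) @: F)).
Proof.
move=> phiI.
pose f (x : T -> R) (v : V) : R := if [pick t | phi t == v] is Some t then x t else 0.
pose g (y : V -> R) (t : T) : R := y (phi t).
have fphi x t : f x (phi t) = x t.
  by rewrite /f; case: pickP => [t' /eqP/phiI -> // | /(_ t)]; rewrite eqxx.
have fout x v : v \notin codom phi -> f x v = 0.
  move=> vN; rewrite /f; case: pickP => // t /eqP tv.
  by rewrite -tv codom_f in vN.
have supp (x : T -> R) : [set v | f x v != 0] = phi @: [set t | x t != 0].
  apply/setP => v; rewrite inE; apply/idP/imsetP => [fv|[t + ->]].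
    have [/codomP[t vt]|/fout fv0] := boolP (v \in codom phi).
      by exists t => //; rewrite inE -fphi -vt.
    by rewrite fv0 eqxx in fv.
  by rewrite inE fphi.
have sumf (x : T -> R) : \sum_v f x v = \sum_t x t.
  rewrite (bigID (mem (codom phi))) /= [X in _ + X]big1 ?addr0 => [|v]; last exact: fout.
  rewrite (eq_bigl (mem [set phi t | t in T])) => [|v].
    rewrite big_imset /=; last by move=> a b _ _; exact: phiI.
    by apply: eq_bigr => t _.
  by rewrite inE; apply/codomP/imsetP => [[t ->]|[t _ ->]]; exists t.
have gF y : realization R ((fun s : {set T} => phi @: s) @: F) y -> f (g y) = y.
  move=> [_ _ /imsetP[s sF ys]]; apply: funext => v.
  have [/codomP[t ->]|vN] := boolP (v \in codom phi); first exact: fphi.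
  rewrite fout //; apply/esym/eqP; apply: contraNT vN => yv.
  have : v \in phi @: s by rewrite -ys inE.
  by case/imsetP => t _ ->; exact: codom_f.
apply: (@homeomorphic_realization R _ _ _ _ f g).
- move=> x [x0 x1 xF]; split; [|by rewrite sumf|by rewrite supp; exact: imset_f].
  by move=> v; rewrite /f; case: pickP.
- move=> y ry; have yE := gF _ ry; have [y0 y1 yF] := ry.
  split; [by move=> t; exact: y0|by rewrite -sumf yE|].
  move: yF; rewrite -{1}yE supp => /imsetP[s sF /imset_inj -> //].
- by move=> x _; apply: funext => t; exact: fphi.
- exact: gF.
- move=> v; rewrite /f; case: pickP => [t _|_].
    exact: (@proj_continuous T (fun=> R) t).
  exact: (@cst_continuous {ptws T -> R} R 0).
- by move=> t; exact: (@proj_continuous V (fun=> R) (phi t)).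
Qed.

(** * Subdivisions *)

Definition down_closed (V : finType) (F : {set {set V}}) : Prop :=
  forall s t : {set V}, s \in F -> t \subset s -> t \in F.

(* All vertices involved in the subdivisions lie in Z; this is what makes them
   commute with joining a set disjoint from Z. *)
Inductive subdiv (V : finType) (Z : {set V}) (F : {set {set V}}) :
    {set {set V}} -> Prop :=
| subdiv_refl : subdiv Z F F
| subdiv_step F' (u v w : V) :
    subdiv Z F F' -> u \in Z -> v \in Z -> w \in Z -> u != v ->
    [set u; v] \in F' -> (forall s, s \in F' -> w \notin s) ->
    subdiv Z F (stellar u v w F').

Lemma subdiv_trans (V : finType) (Z : {set V}) (F G H : {set {set V}}) :
  subdiv Z F G -> subdiv Z G H -> subdiv Z F H.
Proof. by move=> FG; elim=> // F' u v w _; exact: subdiv_step. Qed.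

Lemma subdivS (V : finType) (Z Z' : {set V}) (F G : {set {set V}}) :
  Z \subset Z' -> subdiv Z F G -> subdiv Z' F G.
Proof.
move=> /fintype.subsetP ZZ'; elim=> [|F' u v w _ + /ZZ' uZ /ZZ' vZ /ZZ' wZ].
  exact: subdiv_refl.
by move=> *; exact: subdiv_step.
Qed.

Lemma subdiv_homeomorphic (R : realType) (V : finType) (Z : {set V})
    (F G : {set {set V}}) :
  subdiv Z F G -> homeomorphic (realization_space R F) (realization_space R G).
Proof.
elim=> [|F' u v w _ IH _ _ _ uv uvF wF]; first exact: homeomorphic_refl.
apply: homeomorphic_trans IH _; apply: homeomorphic_stellar => //.
  by apply: contraTneq (wF _ uvF) => ->; rewrite !inE eqxx.
by apply: contraTneq (wF _ uvF) => ->; rewrite !inE eqxx orbT.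
Qed.

Lemma stellar_down_closed (V : finType) (u v w : V) (F : {set {set V}}) :
  down_closed F -> down_closed (stellar u v w F).
Proof.
move=> dF s t; rewrite !inE => /andP[suv sF] ts; apply/andP; split.
  by apply: contra suv => /fintype.subset_trans -> //.
case: ifPn => [wt|wt]; move: sF.
  by rewrite (fintype.subsetP ts _ wt) => /dF -> //; rewrite setSU // setSD.
case: ifPn => [ws /dF -> //|_ /dF -> //].
by apply: subsetU; rewrite subsetD1 ts wt.
Qed.

Lemma subdiv_down_closed (V : finType) (Z : {set V}) (F G : {set {set V}}) :
  down_closed F -> subdiv Z F G -> down_closed G.
Proof. by move=> dF; elim=> // F' u v w _ dF' *; exact: stellar_down_closed. Qed.

(** For induction over the edges of a graph: an edge kept aside is carried unchanged through the
    subdivisions of the others. A new vertex w differs from x and y, which are vertices already, and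
    the subdivided edge uv is not xy, which remains a non-face; the last three claims keep the
    induction going. *)
Lemma subdiv_edge (V : finType) (Z : {set V}) (F G : {set {set V}}) (x y : V) :
  x != y -> [set x] \in F -> [set y] \in F -> [set x; y] \notin F ->
  subdiv Z F G -> subdiv Z ([set x; y] |: F) ([set x; y] |: G) /\
    [/\ [set x] \in G, [set y] \in G & [set x; y] \notin G].
Proof.
move=> xy xF yF xyF; elim=> [|F' u v w _ [IH [xF' yF' xyF']] uZ vZ wZ uv uvF' wF'].
  by split; [exact: subdiv_refl|].
have wx := wF' _ xF'; have wy := wF' _ yF'; rewrite !inE in wx wy.
have uvxy : ~~ ([set u; v] \subset [set x; y]).
  apply: contra xyF' => h; suff <- : [set u; v] = [set x; y] by [].
  by apply/eqP; rewrite eqEcard h !cards2 uv xy.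
have uv1 z : ~~ ([set u; v] \subset [set z]).
  by rewrite subUset !sub1set !inE; apply: contra uv => /andP[/eqP-> /eqP->].
split; last first.
  rewrite !inE !uv1 (negPf wx) (negPf wy) xF' yF'; split=> //.
  by rewrite uvxy /= (negPf xyF').
rewrite [X in subdiv _ _ X](_ : _ = stellar u v w ([set x; y] |: F')).
  apply: subdiv_step => //; first by rewrite inE uvF' orbT.
  by move=> s; rewrite !inE => /orP[/eqP ->|/wF' //]; rewrite !inE negb_or wx wy.
apply/setP => s; rewrite !inE.
have [->|sxy] /= := eqVneq s [set x; y].
  by rewrite uvxy !inE (negPf wx) (negPf wy).
case: (w \in s) => //; rewrite [_ == [set x; y]](_ : _ = false) //.
by apply: contraNF uvxy => /eqP <-; rewrite subsetUr.
Qed.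

(** The join of the discrete set A with F, formed inside one ambient type so that it can be compared
    with a given complex. It is a genuine join when the faces of F avoid A. *)
Definition djoin (V : finType) (A : {set V}) (F : {set {set V}}) : {set {set V}} :=
  [set s : {set V} | (#|s :&: A| <= 1)%N && (s :\: A \in F)].

Lemma djoin_down_closed (V : finType) (A : {set V}) F :
  down_closed F -> down_closed (djoin A F).
Proof.
move=> dF s t; rewrite !inE => /andP[sA sF] ts.
rewrite (leq_trans _ sA) ?subset_leq_card ?setSI //=.
by apply: dF sF _; rewrite setSD.
Qed.

(** As u, v and w lie outside A, the conditions in [stellar] concern only the part of s outside A,
    and the trace of s on A is untouched. *)
Lemma subdiv_djoin (V : finType) (Z A : {set V}) (F G : {set {set V}}) :
  [disjoint A & Z] -> subdiv Z F G -> subdiv Z (djoin A F) (djoin A G).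
Proof.
move=> AZ; elim=> [|F' u v w _ IH uZ vZ wZ uv uvF' wF']; first exact: subdiv_refl.
have notA z : z \in Z -> z \notin A by move=> zZ; rewrite (disjointFl AZ).
have uA := notA _ uZ; have vA := notA _ vZ; have wA := notA _ wZ.
have uvA : [set u; v] :&: A = set0.
  apply/setP => z; rewrite !inE; apply: contraNF uA.
  by move=> /andP[/orP[/eqP <-|/eqP zv]] //; rewrite zv (negPf vA).
have uvDA : [set u; v] :\: A = [set u; v] by rewrite -[LHS]setU0 -uvA setUC setID.
rewrite (_ : djoin A (stellar _ _ _ _) = stellar u v w (djoin A F')).
  apply: subdiv_step => //; first by rewrite inE uvA cards0 uvDA.
  by move=> s; rewrite inE => /andP[_ /wF']; rewrite !inE wA.
apply/setP => s; rewrite !inE wA /=.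
have -> : ([set u; v] \subset s :\: A) = ([set u; v] \subset s).
  by rewrite subsetD -setI_eq0 uvA eqxx andbT.
have -> : ((s :\ w) :|: [set u; v]) :&: A = s :&: A.
  rewrite setIUl uvA setU0; apply/setP => z; rewrite !inE.
  by have [->|//] := eqVneq z w; rewrite (negPf wA) !andbF.
have -> : ((s :\ w) :|: [set u; v]) :\: A = (s :\: A) :\ w :|: [set u; v].
  by rewrite setDUl uvDA; congr (_ :|: _); apply/setP => z; rewrite !inE andbCA.
by rewrite andbCA; case: ifP.
Qed.

(** The first interior vertex w splits xy into xw, an edge of K, and wy, which is treated
    recursively with the rest of the path. *)
Lemma subdiv_path (V : finType) (Z : {set V}) (e : rel V) (K : {set {set V}}) :
  (forall s, s \in K -> (#|s| <= 2)%N) ->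
  (forall z, z \in Z -> [set z] \in K) ->
  (forall a b, a \in Z -> b \in Z -> e a b -> [set a; b] \in K) ->
  forall (p : seq V) (F : {set {set V}}) (x y : V),
    F \subset K -> x \in Z -> y \in Z -> {subset p <= Z} ->
    uniq (x :: y :: p) -> path e x (rcons p y) ->
    (forall s z, s \in F -> z \in p -> z \notin s) ->
  exists2 G, subdiv Z ([set x; y] |: F) G & G \subset K.
Proof.
move=> K2 K1 Ke; elim=> [|w p IH] F x y FK xZ yZ pZ /=.
  move=> _; rewrite andbT => exy _; exists ([set x; y] |: F); first exact: subdiv_refl.
  by rewrite subUset sub1set FK Ke.
rewrite !inE !negb_or => /and3P[/and3P[xy xw xp] /andP[yw yp] /andP[wp up]].
move=> /andP[exw pw] fr.
have wZ : w \in Z by apply: pZ; rewrite inE eqxx.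
(* The unfinished edge wy is set aside: it need not lie in K, whereas all of [F2] does. *)
pose F1 := stellar x y w ([set x; y] |: F); pose F2 := F1 :\ [set w; y].
have wF s : s \in [set x; y] |: F -> w \notin s.
  rewrite !inE => /orP[/eqP ->|sF]; last by apply: fr sF _; rewrite inE eqxx.
  by rewrite !inE negb_or eq_sym xw eq_sym yw.
have S1 : subdiv Z ([set x; y] |: F) F1.
  by apply: subdiv_step => //; [exact: subdiv_refl | rewrite !inE eqxx].
have F1E : F1 = [set w; y] |: F2.
  rewrite setD1K // !inE eqxx /= subUset !sub1set !inE (negPf xw) (negPf xy) /=.
  rewrite (_ : _ :|: _ = [set x; y]) ?eqxx //; apply/setP => z; rewrite !inE.
  by have [->|] := eqVneq z w; rewrite //= ?(eq_sym w) ?(negPf xw) ?(negPf yw) // orbC -orbA orbb.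
(* A face with at most two vertices that contains x and y is xy itself, so the only faces gained are
   w, xw and wy, and wy has been removed. *)
have F2sub s : s \in F2 -> [|| s \in F, s == [set w] | s == [set x; w]].
  rewrite !inE => /andP[swy /andP[xys]]; case: ifPn => [ws sF|ws].
    have {sF} sE : (s :\ w) \subset [set x; y].
      have : s :\ w :|: [set x; y] == [set x; y].
        rewrite eq_sym eqEcard subsetUr /=; rewrite cards2 xy.
        by case/orP: sF => [/eqP->|/(fintype.subsetP FK)/K2 //]; rewrite cards2 xy.
      by move/eqP => <-; rewrite subsetUl.
    have sz z : z \in s -> [|| z == w, z == x | z == y].
      move=> zs; have [//|zw] := eqVneq z w.
      by have := fintype.subsetP sE z; rewrite !inE zw zs; apply.
    have [xs|xs] := boolP (x \in s).
      have ys : y \notin s by move: xys; rewrite subUset !sub1set xs.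
      apply/orP; right; apply/orP; right; apply/eqP/setP => z; rewrite !inE.
      apply/idP/orP => [zs|[/eqP->//|/eqP->//]].
      by case/or3P: (sz z zs) => [->|->|/eqP zy]; [right|left|rewrite -zy zs in ys].
    have [ys|ys] := boolP (y \in s).
      case/negP: swy; apply/eqP/setP => z; rewrite !inE.
      apply/idP/orP => [zs|[/eqP->//|/eqP->//]].
      by case/or3P: (sz z zs) => [->|/eqP zx|->]; [left|rewrite -zx zs in xs|right].
    apply/orP; right; apply/orP; left; apply/eqP/setP => z; rewrite !inE.
    apply/idP/eqP => [zs|-> //].
    by case/or3P: (sz z zs) => /eqP // zz; [rewrite -zz zs in xs|rewrite -zz zs in ys].
  by case/orP => [/eqP sE|-> //]; rewrite sE fintype.subxx in xys.
have [|||||||G S2 GK] := IH F2 w y.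
- apply/fintype.subsetP => s /F2sub /or3P[/(fintype.subsetP FK) //|/eqP ->|/eqP ->].
    exact: K1.
  exact: Ke.
- exact: wZ.
- exact: yZ.
- by move=> z zp; apply: pZ; rewrite inE zp orbT.
- by rewrite /= !inE negb_or (eq_sym w) yw wp yp.
- exact: pw.
- move=> s z /F2sub /or3P[sF zp|/eqP-> zp|/eqP-> zp].
  + by apply: fr sF _; rewrite inE zp orbT.
  + by rewrite inE; apply: contraNneq wp => <-.
  + by rewrite !inE negb_or; apply/andP; split; [apply: contraNneq xp|apply: contraNneq wp] => <-.
by exists G => //; apply: subdiv_trans S1 _; rewrite F1E.
Qed.

(** * Mader's theorem *)

(** Twice the number of edges inside W when e is symmetric and irreflexive. *)
Definition degree_sum (V : finType) (e : rel V) (W : {set V}) : nat :=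
  (\sum_(x in W) #|[set y in W | e x y]|)%N.

Definition nbrs (V : finType) (e : rel V) (W U : {set V}) : {set V} :=
  [set x in W :\: U | [exists u in U, e x u]].

Lemma degree_sumD1 (V : finType) (e : rel V) (W : {set V}) (x : V) :
  symmetric e -> irreflexive e -> x \in W ->
  degree_sum e W = (degree_sum e (W :\ x) + 2 * #|[set y in W | e x y]|)%N.
Proof.
move=> es ei xW; rewrite /degree_sum (big_setD1 x) //= addnC mul2n -addnn addnA.
congr (_ + _)%N; rewrite -[#|[set y in W | e x y]|]sum1_card.
rewrite [X in (_ + X)%N](_ : _ = \sum_(y in W :\ x) e y x)%N; last first.
  rewrite big_mkcond /= [RHS]big_mkcond /=; apply: eq_bigr => y _.
  rewrite !inE es; have [->|yx] := eqVneq y x; first by rewrite ei andbF.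
  by rewrite /=; case: (y \in W) => //=; case: (e y x).
rewrite -big_split /=; apply: eq_bigr => y; rewrite !inE => /andP[yx yW].
rewrite (cardsD1 x) !inE xW addnC /=; congr (_ + _)%N; apply: eq_card => z.
by rewrite !inE andbA.
Qed.

Definition induced (V : finType) (e : rel V) (U : {set V}) : rel V :=
  [rel a b | [&& a \in U, b \in U & e a b]].

Definition connected_in (V : finType) (e : rel V) (U : {set V}) : bool :=
  [forall x in U, [forall y in U, connect (induced e U) x y]].

Lemma connected_inU1 (V : finType) (e : rel V) (U : {set V}) (x u : V) :
  symmetric e -> connected_in e U -> u \in U -> e x u ->
  connected_in e (x |: U).
Proof.
move=> es /forallP cU uU exu.
have {}cU b : b \in U -> connect (induced e U) u b.
  by move: (cU u); rewrite uU => /forallP/(_ b)/implyP.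
have mono a b : connect (induced e U) a b -> connect (induced e (x |: U)) a b.
  apply: connect_sub => {}a {}b /= /and3P[aU bU eab]; apply: connect1.
  by rewrite /induced /= !inE aU bU eab !orbT.
have sym : connect_sym (induced e (x |: U)).
  by apply: sym_connect_sym => a b; rewrite /induced /= es andbCA.
have toU y : y \in U -> connect (induced e (x |: U)) x y.
  move=> yU; apply: (@connect_trans _ _ u); last by apply: mono; exact: cU.
  by apply: connect1; rewrite /induced /= !inE eqxx uU exu orbT.
have fromx y : y \in x |: U -> connect (induced e (x |: U)) x y.
  by rewrite !inE => /orP[/eqP -> //|/toU].
apply/forallP => y; apply/implyP => yU; apply/forallP => z; apply/implyP => zU.
by apply: connect_trans (fromx _ zU); rewrite sym fromx.
Qed.

Lemma connected_in_path (V : finType) (e : rel V) (U : {set V}) (x y u v : V) :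
  connected_in e U -> u \in U -> v \in U -> e x u -> e v y ->
  exists p, [/\ {subset p <= U}, uniq p & path e x (rcons p y)].
Proof.
move=> /forallP/(_ u)/implyP cU uU vU exu evy.
move/forallP/(_ v)/implyP/(_ vU)/connectP: (cU uU) => [q].
case/shortenP => q' pq' uq' _ vE; exists (u :: q'); split=> //.
  move=> z; rewrite inE => /orP[/eqP -> //|].
  elim: q' u pq' {uq' vE exu cU uU} => //= c q' IH u /andP[/and3P[_ cU _] pc].
  by rewrite inE => /orP[/eqP ->//|]; exact: IH pc.
rewrite /= exu rcons_path -vE evy andbT.
by apply: sub_path pq' => a b /and3P[].
Qed.

(* After passing to a minimal dense W, take U maximal among the connected sets whose
   contraction keeps the graph dense, and N its neighbourhood: if some x in N had
   fewer than D neighbours in N, then x could be contracted into U as well. *)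
Lemma dense_neighbourhood (V : finType) (e : rel V) (D : nat) :
  symmetric e -> irreflexive e -> (0 < D)%N ->
  forall W : {set V}, W != set0 -> (2 * D * #|W| <= degree_sum e W)%N ->
  exists U N : {set V}, [/\ N \subset W /\ U \subset W, [disjoint U & N],
    N != set0, (D * #|N| <= degree_sum e N)%N
    & connected_in e U /\ forall x, x \in N -> exists2 u, u \in U & e x u].
Proof.
move=> es ei D0 W; have [k] := ubnP #|W|; elim: k W => // k IH W Wk W0 WD.
have [/existsP[W' /and3P[W'W W'0 W'D]]|] := boolP [exists W' : {set V},
    [&& W' \proper W, W' != set0 & (2 * D * #|W'| <= degree_sum e W')%N]].
  have W'k : (#|W'| < k)%N := leq_trans (proper_card W'W) Wk.
  have [U [N [[NW' UW'] dUN N0 ND cU]]] := IH W' W'k W'0 W'D.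
  have W'W' := proper_sub W'W.
  exists U, N; split=> //; split; exact: fintype.subset_trans W'W'.
rewrite negb_exists => /forallP minW.
(* The inequality is the density condition for W with U contracted to a single vertex, whose degree
   is the number of neighbours of U. *)
pose P (U : {set V}) := [&& U \subset W, U != set0, connected_in e U &
  (2 * D * (#|W :\: U| + 1) <= degree_sum e (W :\: U) + 2 * #|nbrs e W U|)%N].
have [v vW] := set0Pn _ W0.
have Pv : P [set v].
  apply/and4P; split; first by rewrite sub1set.
  - by apply/set0Pn; exists v; rewrite inE.
  - apply/forallP => x; apply/implyP => /set1P ->.
    by apply/forallP => y; apply/implyP => /set1P ->.
  rewrite (degree_sumD1 (x := v)) // (cardsD1 v) vW addnC in WD.
  apply: leq_trans WD _; rewrite leq_add2l leq_mul2l /=.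
  apply/subset_leq_card/fintype.subsetP => y; rewrite !inE => /andP[yW evy].
  rewrite yW andbT; apply/andP; split.
    by apply: contraTneq evy => ->; rewrite ei.
  by apply/existsP; exists v; rewrite inE eqxx es.
case: (@arg_maxnP _ [set v] P (fun U => #|U|) Pv) => U /and4P[UW U0 cU DU] Umax.
set N := nbrs e W U in DU; pose X := W :\: U; rewrite -/X in DU.
have NX : N \subset X by apply/fintype.subsetP => x; rewrite inE => /andP[].
have XW : X \subset W by rewrite subsetDl.
exists U, N; split=> //.
- by split=> //; exact: fintype.subset_trans NX XW.
- rewrite disjoint_sym disjoint_subset; apply/fintype.subsetP => x.
  by rewrite !inE => /andP[/andP[]].
(* Were N empty, the contracted vertex would be isolated and [X], a proper part of W, would still be
   dense. For empty [X] the inequality itself fails, as D is positive. *)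
- apply/negP => /eqP N0; rewrite N0 cards0 muln0 addn0 in DU.
  have [X0|X0] := eqVneq X set0.
    by move: DU; rewrite X0 cards0 /degree_sum big_set0; lia.
  have := minW X; rewrite X0 /= properE XW /=.
  have -> /= : ~~ (W \subset X).
    have [u uU] := set0Pn _ U0; apply/negP => /fintype.subsetP/(_ u).
    by rewrite (fintype.subsetP UW _ uU) inE uU => /(_ isT).
  by case/negP; apply: leq_trans DU; rewrite leq_mul2l leq_addr orbT.
- rewrite /degree_sum mulnC -sum_nat_const; apply: leq_sum => x xN.
  have xX := fintype.subsetP NX _ xN.
  have [xW xU] : x \in W /\ x \notin U by move: xX; rewrite inE => /andP[].
  have /existsP[u /andP[uU exu]] : [exists u in U, e x u] by move: xN; rewrite inE => /andP[].
  have : ~~ P (x |: U).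
    by apply/negP => /Umax; rewrite cardsU1 xU; lia.
  rewrite /P subUset sub1set xW UW (connected_inU1 es cU uU exu) /=.
  have -> /= : x |: U != set0 by apply/set0Pn; exists x; rewrite !inE eqxx.
  have -> : W :\: (x |: U) = X :\ x by rewrite setUC setDDl.
  rewrite -ltnNge => Dx.
  rewrite (degree_sumD1 es ei xX) (cardsD1 x X) xX in DU.
  have cX : #|[set y in X | e x y]| =
      (#|[set y in N | e x y]| + #|[set y in X | e x y] :\: N|)%N.
    rewrite -[LHS](cardsID N); congr (#|pred_of_set _| + _)%N.
    apply/setP => y; apply/setIP/setIdP => [[/setIdP[_ exy] yN] //|[yN exy]].
    by split=> //; apply/setIdP; split=> //; exact: fintype.subsetP NX _ yN.
  (* Contracting x as well loses one vertex, the edge from x to U, and one edge for each neighbour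
     of x in N, which becomes parallel to another. By maximality of U this loss exceeds D edges, so
     x has at least D neighbours in N. *)
  have cN : (#|N :\ x| + #|[set y in X | e x y] :\: N| <= #|nbrs e W (x |: U)|)%N.
    rewrite -cardsUI (_ : _ :&: _ = set0) ?cards0 ?addn0; last first.
      apply/setP => y; rewrite in_set0; apply/negP.
      by move=> /setIP[/setD1P[_ yN] /setDP[_]]; rewrite yN.
    apply/subset_leq_card/fintype.subsetP => y.
    rewrite [y \in nbrs _ _ _]inE => /setUP[/setD1P[yx yN]|/setDP[yX yN]].
      move: yN; rewrite !inE => /andP[/andP[yU yW] /existsP[u' /andP[u'U eyu]]].
      rewrite (negPf yx) yU yW /=; apply/existsP; exists u'.
      by rewrite !inE u'U orbT.
    move: yX; rewrite !inE => /andP[/andP[yU yW] exy]; rewrite yW (negPf yU) orbF andbT.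
    apply/andP; split; first by apply: contraTneq exy => ->; rewrite ei.
    by apply/existsP; exists x; rewrite !inE eqxx es.
  rewrite (cardsD1 x N) xN in DU; move: DU Dx cN; rewrite cX.
  set a := #|[set y in N | e x y]|; set b := #|_ :\: N|; set c := #|nbrs _ _ _|.
  set f := #|N :\ x|; set g := degree_sum _ _; set h := #|X :\ x|.
  clearbody a b c f g h => DU Dx cN; clear -DU Dx cN; nia.
split=> // x; rewrite inE => /andP[_ /existsP[u /andP[uU exu]]].
by exists u.
Qed.

(** The graph on T with edge list l, placed in V by b. Keeping the edges in a list allows induction
    on them. *)
Definition edge_family (T V : finType) (b : T -> V) (l : seq (T * T)) : {set {set V}} :=
  [set s : {set V} | [|| s == set0, [exists t, s == [set b t]]
     | has (fun p : T * T => s == [set b p.1; b p.2]) l]].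

Definition graph_complex (V : finType) (e : rel V) (W : {set V}) : {set {set V}} :=
  [set s : {set V} | [|| s == set0, [exists x in W, s == [set x]]
     | [exists x in W, [exists y in W, e x y && (s == [set x; y])]]]].

Lemma graph_complexS (V : finType) (e : rel V) (W W' : {set V}) :
  W \subset W' -> graph_complex e W \subset graph_complex e W'.
Proof.
move=> /fintype.subsetP WW; apply/fintype.subsetP => s; rewrite !inE.
case/or3P => [->//|/existsP[x /andP[xW sx]]|/existsP[x /andP[xW /existsP[y /andP[yW sxy]]]]].
  by apply/orP; right; apply/orP; left; apply/existsP; exists x; rewrite WW.
apply/orP; right; apply/orP; right; apply/existsP; exists x; rewrite WW //=.
by apply/existsP; exists y; rewrite WW.
Qed.

Lemma graph_complex_sub (V : finType) (e : rel V) (W s : {set V}) :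
  s \in graph_complex e W -> s \subset W.
Proof.
rewrite inE; case/or3P => [/eqP ->|/existsP[x /andP[xW /eqP ->]]|].
- exact: sub0set.
- by rewrite sub1set.
by case/existsP=> x /andP[xW /existsP[y /and3P[yW _ /eqP->]]]; rewrite subUset !sub1set xW.
Qed.

Lemma card_graph_complex (V : finType) (e : rel V) (W s : {set V}) :
  s \in graph_complex e W -> (#|s| <= 2)%N.
Proof.
rewrite inE; case/or3P => [/eqP ->|/existsP[x /andP[xW /eqP ->]]|].
- by rewrite cards0.
- by rewrite cards1.
by case/existsP=> x /andP[xW /existsP[y /and3P[yW _ /eqP->]]]; rewrite cards2; case: (_ != _).
Qed.

(* All edges but one are realized inside N by induction, which leaves the connected
   set U free for the path realizing the last edge. *)
Lemma mader (T : finType) (l : seq (T * T)) :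
  all (fun p => p.1 != p.2) l ->
  forall (V : finType) (e : rel V) (W : {set V}),
  symmetric e -> irreflexive e -> W != set0 ->
  (2 ^ size l * #|T|.+1 * #|W| <= degree_sum e W)%N ->
  exists2 b : T -> V, injective b & (forall t, b t \in W) /\
  exists2 G, subdiv W (edge_family b l) G & G \subset graph_complex e W.
Proof.
elim: l => [_|[a c] l IH] /=.
  move=> V e W es ei W0; rewrite expn0 mul1n => WD.
  have [x0 _] := set0Pn _ W0.
  (* No degree in W exceeds [#|W|], so the density forces W to have room for all vertices of T. *)
  have TW : (#|T| < #|W|.+1)%N.
    have : (#|T|.+1 * #|W| <= #|W| * #|W|)%N.
      apply: leq_trans WD _; rewrite -sum_nat_const; apply: leq_sum => x _.
      by apply/subset_leq_card/fintype.subsetP => y; rewrite inE => /andP[].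
    by rewrite leq_pmul2r ?card_gt0 // => /ltnW.
  have tW (t : T) : (enum_rank t < size (enum W))%N.
    by rewrite -cardE (leq_trans (ltn_ord _)).
  pose b (t : T) := nth x0 (enum W) (enum_rank t).
  have bW t : b t \in W by rewrite -mem_enum mem_nth.
  exists b.
    by move=> t t' /eqP; rewrite nth_uniq ?enum_uniq // => /eqP/val_inj/enum_rank_inj.
  split=> //; exists (edge_family b [::]); first exact: subdiv_refl.
  apply/fintype.subsetP => s; rewrite !inE orbF => /orP[->//|/existsP[t st]].
  by apply/orP; right; apply/orP; left; apply/existsP; exists (b t); rewrite bW.
(* Passing from W to N halves the density, once per edge, whence the factor [2 ^ size l]. *)
move=> /andP[ac /IH {}IH] V e W es ei W0; rewrite expnS -[(2 * _ * _)%N]mulnA => WD.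
have D0 : (0 < 2 ^ size l * #|T|.+1)%N by rewrite muln_gt0 expn_gt0.
have [U [N [[NW UW] dUN N0 ND [cU eU]]]] := dense_neighbourhood es ei D0 W0 WD.
have [b binj [bN [G EG GK]]] := IH V e N es ei N0 ND.
have bW t : b t \in W := fintype.subsetP NW _ (bN t).
exists b => //; split=> //.
(* The pair may repeat an earlier edge, possibly reversed; then it adds no face. *)
have [acE|acE] := boolP ([set b a; b c] \in edge_family b l).
  rewrite (_ : edge_family b _ = edge_family b l); last first.
    apply/setP => s; rewrite !inE /=; have [->|//] := eqVneq s [set b a; b c].
    by move: acE; rewrite !inE => ->; rewrite !orbT.
  exists G; first exact: subdivS EG.
  exact: fintype.subset_trans GK (graph_complexS _ NW).
have -> : edge_family b ((a, c) :: l) = [set b a; b c] |: edge_family b l.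
  by apply/setP => s; rewrite !inE /=; do !case: (_ == _); rewrite ?orbT.
have bac : b a != b c by rewrite (inj_eq binj).
have vert t : [set b t] \in edge_family b l.
  by rewrite !inE; apply/orP; right; apply/orP; left; apply/existsP; exists t.
have [S1 _] := subdiv_edge bac (vert a) (vert c) acE EG.
have [u uU eau] := eU _ (bN a); have [v vU ecv] := eU _ (bN c).
rewrite es in ecv.
(* The faces of G have their vertices in N and the interior of the path lies in U, so the path is
   fresh. *)
have [p [pU up pp]] := connected_in_path cU uU vU eau ecv.
have UN z : z \in U -> z \notin N by move=> zU; rewrite (disjointFr dUN).
have [||||||||||G' S2 G'K] := @subdiv_path V W e (graph_complex e W) _ _ _ p G (b a) (b c).
- exact: card_graph_complex.
- move=> z zW; rewrite !inE; apply/orP; right; apply/orP; left; apply/existsP; exists z.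
  by rewrite zW /=.
- move=> x y xW yW exy; rewrite !inE; apply/orP; right; apply/orP; right.
  by apply/existsP; exists x; rewrite xW; apply/existsP; exists y; rewrite yW exy /=.
- exact: fintype.subset_trans GK (graph_complexS _ NW).
- exact: bW.
- exact: bW.
- by move=> z /pU; exact: (fintype.subsetP UW).
- rewrite /= inE negb_or bac up andbT /=; apply/andP; split.
    by apply: contraTN (bN a) => /pU/UN.
  by apply: contraTN (bN c) => /pU/UN.
- exact: pp.
- move=> s z sG /pU/UN; apply: contra => zs.
  by move: (graph_complex_sub (fintype.subsetP GK _ sG)) => /fintype.subsetP/(_ _ zs).
exists G' => //; exact: subdiv_trans (subdivS NW S1) S2.
Qed.

(** * Joins of discrete sets *)

Definition pairwise_disjoint (V : finType) (As : seq {set V}) : bool :=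
  pairwise (fun A B : {set V} => [disjoint A & B]) As.

(** The base [[set set0]], whose only face is empty, is the unit of the join. *)
Definition discrete_join (V : finType) (As : seq {set V}) : {set {set V}} :=
  foldr (@djoin V) [set set0] As.

(** Disjointness makes the successive removals in [djoin] harmless: taking away A does not change
    the trace on a later B. *)
Lemma mem_discrete_join (V : finType) (As : seq {set V}) (s : {set V}) :
  pairwise_disjoint As ->
  (s \in discrete_join As) = (s \subset \bigcup_(A <- As) A) &&
                             all (fun A => #|s :&: A| <= 1)%N As.
Proof.
rewrite /pairwise_disjoint.
elim: As s => [|A As IH] s /=; first by rewrite big_nil inE subset0 andbT.
case/andP => /allP dA pAs; rewrite inE IH // big_cons subDset andbCA.
congr [&& _, _ & _]; apply: eq_in_all => B BAs.
congr (#|pred_of_set _| <= 1)%N; apply/setP => z; rewrite !inE.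
by have [zB|] := boolP (z \in B); rewrite ?andbF // (disjointFl (dA _ BAs)).
Qed.

Lemma discrete_join_down_closed (V : finType) (As : seq {set V}) :
  down_closed (discrete_join As).
Proof.
elim: As => [|A As IH] /=; last exact: djoin_down_closed.
by move=> s t /set1P -> ; rewrite subset0 => /eqP ->; rewrite inE.
Qed.

(** Coordinates with sum 1 cannot have empty support. This reconciles families containing the empty
    face with complexes, which exclude it. *)
Lemma realizationD0 (R : realType) (V : finType) (F : {set {set V}}) :
  realization R (F :\ set0) = realization R F.
Proof.
apply/seteqP; split=> x [x0 x1 xF]; split=> //; first by case/setD1P: xF.
apply/setD1P; split=> //; apply: contraTneq isT => s0.
suff : \sum_v x v = 0 by rewrite x1 => /eqP; rewrite oner_eq0.
apply: big1 => v _; apply/eqP; apply: contraTT isT => xv.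
have : v \in [set v | x v != 0] by rewrite inE.
by rewrite s0 inE.
Qed.

Lemma homeomorphic_discrete_join (R : realType) (V : finType) (As : seq {set V})
    (r : nat) :
  (0 < r)%N -> (0 < size As)%N -> (forall A, A \in As -> #|A| = r) ->
  pairwise_disjoint As ->
  homeomorphic (realization_space R (discrete_join As))
               (realization_space R (join_power (size As) r)).
Proof.
move=> r0 k0 Ar dAs.
have AsE (i : 'I_(size As)) : nth set0 As i \in As by exact: mem_nth.
(* [x0] only serves as default value for [nth]; the map [phi] sends (i, a) to the a-th element of
   the i-th set. *)
have [x0 _] : exists x0, x0 \in nth set0 As (Ordinal k0).
  by apply/set0Pn; rewrite -card_gt0 Ar.
pose phi (p : 'I_(size As) * 'I_r) := nth x0 (enum (nth set0 As p.1)) p.2.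
have phiA p : phi p \in nth set0 As p.1.
  by rewrite -mem_enum mem_nth // -cardE Ar.
have phiB (p : 'I_(size As) * 'I_r) (i : 'I_(size As)) :
    phi p \in nth set0 As i -> p.1 = i.
  move=> pi; apply/val_inj/eqP; apply: contraTT isT => pni.
  have dis (i1 i2 : 'I_(size As)) : (i1 < i2)%N -> [disjoint nth set0 As i1 & nth set0 As i2].
    by apply: (pairwiseP set0 dAs); rewrite inE.
  have := phiA p; move: pni; rewrite neq_ltn => /orP[/dis d|/dis d].
    by rewrite (disjointFl d pi).
  by rewrite (disjointFr d pi).
have phiI : injective phi.
  move=> p q pq; have pq1 : p.1 = q.1 by apply: phiB; rewrite pq.
  move: p q pq pq1 => [i a] [j b] /= + ij; rewrite ij /phi /= => /eqP.
  by rewrite nth_uniq ?enum_uniq -?cardE ?Ar // => /eqP/val_inj ->.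
have phiS v : v \in \bigcup_(A <- As) A -> exists p, v = phi p.
  rewrite bigcup_seq => /bigcupP[A AAs vA].
  have iA : (index A As < size As)%N by rewrite index_mem.
  have vi : (index v (enum A) < r)%N by rewrite -(Ar A AAs) cardE index_mem mem_enum.
  by exists (Ordinal iA, Ordinal vi); rewrite /phi /= nth_index // nth_index // mem_enum.
rewrite /realization_space -realizationD0.
rewrite (_ : discrete_join As :\ set0 =
    (fun s : {set _} => phi @: s) @: join_power (size As) r).
  by apply: homeomorphic_sym; exact: homeomorphic_imset.
apply/setP => s; rewrite in_setD1 mem_discrete_join //.
apply/and3P/imsetP => [[s0 sAs /allP scard]|[t]].
  have sE : s = phi @: [set p | phi p \in s].
    apply/setP => v; apply/idP/imsetP => [vs|[p + ->]]; last by rewrite inE.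
    have [p vp] := phiS _ (fintype.subsetP sAs _ vs).
    by exists p; rewrite ?inE -?vp.
  exists [set p | phi p \in s] => //; rewrite inE; apply/andP; split.
    by apply: contraNneq s0 => t0; rewrite sE t0 imset0.
  apply/forallP => i; apply: leq_trans (scard _ (AsE i)).
  rewrite -(card_imset _ phiI); apply/subset_leq_card/fintype.subsetP => v.
  case/imsetP => p; rewrite !inE => /andP[ps /eqP pi] ->.
  by rewrite ps -pi phiA.
rewrite inE => /andP[t0 /forallP tc] ->; split.
- by apply: contraNneq t0 => /eqP; rewrite imset_eq0.
- apply/fintype.subsetP => v /imsetP[p _ ->]; rewrite bigcup_seq.
  by apply/bigcupP; exists (nth set0 As p.1).
apply/allP => A AAs; have iA : (index A As < size As)%N by rewrite index_mem.
apply: leq_trans (tc (Ordinal iA)); rewrite -[leqRHS](card_imset _ phiI).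
apply/subset_leq_card/fintype.subsetP => v /setIP[/imsetP[p pt ->] pA].
apply/imset_f; rewrite !inE pt; apply/eqP/phiB.
by rewrite /= nth_index.
Qed.

Definition bipartite_edges (r : nat) : seq ((bool * 'I_r) * (bool * 'I_r)) :=
  [seq ((true, i), (false, j)) | i <- enum 'I_r, j <- enum 'I_r].

Lemma set_card_le1 (V : finType) (A : {set V}) :
  (#|A| <= 1)%N -> A = set0 \/ exists x, A = [set x].
Proof.
rewrite leq_eqVlt ltnS leqn0 cards_eq0 => /orP[/cards1P|/eqP]; [by right|by left].
Qed.

(** K_{r,r} is the join of its two sides: the graph supplied by Mader's theorem thus becomes the
    last two factors of the join. *)
Lemma edge_family_bipartite (V : finType) (r : nat) (b : bool * 'I_r -> V) :
  injective b ->
  let B c := [set b (c, i) | i in 'I_r] in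
  edge_family b (bipartite_edges r) = discrete_join [:: B true; B false] /\
  pairwise_disjoint [:: B true; B false].
Proof.
move=> bI B.
have bB c t : (b t \in B c) = (t.1 == c).
  apply/imsetP/eqP => [[i _ /bI -> //]|<-]; by exists t.2; case: t.
have dB : pairwise_disjoint [:: B true; B false].
  rewrite /pairwise_disjoint /= !andbT -setI_eq0; apply/eqP/setP => x.
  rewrite !inE; apply/negP => /andP[/imsetP[i _ ->]]; by rewrite bB.
split=> //; apply/setP => s; rewrite mem_discrete_join //= inE.
rewrite big_cons big_seq1 andbT.
have BT t : b t \in B true :|: B false by case: t => [[] i]; rewrite in_setU !bB.
apply/or3P/and3P.
  case=> [/eqP->|/existsP[t /eqP ->]|/hasP[p /allpairsP[[i j] /= [_ _ ->]] /eqP ->]].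
  - by rewrite sub0set !set0I !cards0.
  - rewrite sub1set BT; split=> //;
    by apply: leq_trans (subset_leq_card (subsetIl _ _)) _; rewrite cards1.
  - rewrite subUset !sub1set !BT /=; split=> //; rewrite setIUl.
      rewrite [X in _ :|: X](_ : _ = set0) ?setU0; last first.
        by apply/setP => z; rewrite !inE; apply/negP => /andP[/eqP ->]; rewrite bB.
      by apply: leq_trans (subset_leq_card (subsetIl _ _)) _; rewrite cards1.
    rewrite [X in X :|: _](_ : _ = set0) ?set0U; last first.
      by apply/setP => z; rewrite !inE; apply/negP => /andP[/eqP ->]; rewrite bB.
    by apply: leq_trans (subset_leq_card (subsetIl _ _)) _; rewrite cards1.
case=> sB /set_card_le1 s1 /set_card_le1 s2.
have sE : s = (s :&: B true) :|: (s :&: B false) by rewrite -setIUr; apply/esym/setIidPl.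
have inB c x : s :&: B c = [set x] -> exists i, x = b (c, i).
  move=> h; have : x \in s :&: B c by rewrite h inE.
  by case/setIP => _ /imsetP[i _ ->]; exists i.
case: s1 => [s1|[x s1]]; case: s2 => [s2|[y s2]]; rewrite sE s1 s2.
- by rewrite setU0 eqxx; constructor.
- have [i ->] := inB _ _ s2; rewrite set0U; constructor 2.
  by apply/existsP; exists (false, i).
- have [i ->] := inB _ _ s1; rewrite setU0; constructor 2.
  by apply/existsP; exists (true, i).
have [i ->] := inB _ _ s1; have [j ->] := inB _ _ s2; constructor 3.
apply/hasP; exists ((true, i), (false, j)) => //=.
by apply/allpairsP; exists (i, j); rewrite !mem_enum.
Qed.

(** * Counting common links *)

Lemma expn_leq (a b m : nat) : (a <= b)%N -> (a ^ m <= b ^ m)%N.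
Proof. by case: m => // m ab; rewrite leq_exp2r. Qed.

Lemma rearrangement_expn (a b m : nat) :
  (a * b ^ m + b * a ^ m <= a * a ^ m + b * b ^ m)%N.
Proof.
have [ab|/ltnW ab] := leqP a b; have := expn_leq m ab; nia.
Qed.

(** The power mean inequality without denominators. The induction step is Chebyshev's sum
    inequality. *)
Lemma expn_sum_leq (I : finType) (P : {pred I}) (a : I -> nat) (m : nat) :
  ((\sum_(i in P) a i) ^ m.+1 <= #|P| ^ m * \sum_(i in P) a i ^ m.+1)%N.
Proof.
elim: m => [|m IH].
  by rewrite expn0 mul1n expn1; apply: leq_sum => i _; rewrite expn1.
rewrite expnS (leq_trans (leq_mul (leqnn _) IH)) // mulnCA expnSr -mulnA leq_mul2l.
(* Doubling turns both sides into double sums that can be symmetrized in i and j and then compared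
   term by term. *)
apply/orP; right; rewrite -(leq_pmul2l (isT : 0 < 2)%N) !mul2n -!addnn.
rewrite -!sum_nat_const [X in (_ <= X + _)%N]exchange_big /= -!big_split /=.
rewrite [X in (X + _ <= _)%N]big_distrlr [X in (_ + X <= _)%N]big_distrlr /=.
rewrite [X in (_ + X <= _)%N]exchange_big /= -big_split /=.
apply: leq_sum => i _; rewrite -!big_split /=; apply: leq_sum => j _.
rewrite !(expnS _ m.+1); exact: rearrangement_expn.
Qed.

Lemma ffact_leq_expn (n m : nat) : (n ^_ m <= n ^ m)%N.
Proof.
by elim: m => // m IH; rewrite ffactnSr expnSr leq_mul ?leq_subr.
Qed.

Lemma bin_leq_expn (n m : nat) : ('C(n, m) <= n ^ m)%N.
Proof.
by rewrite (leq_trans _ (ffact_leq_expn n m)) // -bin_ffact leq_pmulr // fact_gt0.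
Qed.

(** All r factors are at least n - r, and truncated subtraction covers n < r. *)
Lemma expn_leq_ffact (n r : nat) : ((n - r) ^ r <= n ^_ r)%N.
Proof.
suff h j : (j <= r)%N -> ((n - r) ^ j <= n ^_ j)%N by exact: h.
elim: j => // j IH jr; rewrite ffactnSr expnSr leq_mul ?IH ?(ltnW jr) //.
by rewrite leq_sub2l // ltnW.
Qed.

Lemma card_bigcup_leq (I T : finType) (P : {pred I}) (F : I -> {set T}) :
  (#|\bigcup_(i in P) F i| <= \sum_(i in P) #|F i|)%N.
Proof.
elim/big_rec2: _ => [|i m A _ Am]; first by rewrite cards0.
by apply: leq_trans (leq_card_setU _ _) _; rewrite leq_add2l.
Qed.

Definition faces (V : finType) (k : nat) (K : {set {set V}}) : {set {set V}} :=
  [set s in K | #|s| == k].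

Definition common_link (V : finType) (A : {set V}) (K : {set {set V}}) : {set {set V}} :=
  [set t in K | [disjoint A & t] & [forall v in A, v |: t \in K]].

Lemma common_link_down_closed (V : finType) (A : {set V}) K :
  down_closed K -> down_closed (common_link A K).
Proof.
move=> dK s t; rewrite !inE => /and3P[sK As /forallP sA] ts.
rewrite (dK _ _ sK ts) (disjointWr ts As) /=; apply/forallP => v; apply/implyP => vA.
by have := sA v; rewrite vA /= => /dK; apply; rewrite setUS.
Qed.

Definition extensions (V : finType) (K : {set {set V}}) (t : {set V}) : {set V} :=
  [set v | (v \notin t) && (v |: t \in K)].

Lemma card_faces_leq (V : finType) (K : {set {set V}}) (k : nat) :
  down_closed K ->
  (#|faces k.+1 K| <= \sum_(t in faces k K) #|extensions K t|)%N.
Proof.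
move=> dK; apply: (@leq_trans
  #|\bigcup_(t in faces k K) (fun v => v |: t) @: extensions K t|); last first.
  apply: leq_trans (card_bigcup_leq _ _) _; apply: leq_sum => t _.
  exact: leq_imset_card.
apply/subset_leq_card/fintype.subsetP => s; rewrite inE => /andP[sK /eqP sk].
have [v vs] : exists v, v \in s by apply/set0Pn; rewrite -card_gt0 sk.
apply/bigcupP; exists (s :\ v).
  rewrite inE (dK _ _ sK (subD1set _ _)) /=.
  by move: sk; rewrite (cardsD1 v) vs => -[<-].
by apply/imsetP; exists v; rewrite ?inE ?eqxx ?setD1K.
Qed.

Lemma card_faces_expn (V : finType) (K : {set {set V}}) (n k : nat) :
  (#|cover K| <= n)%N -> (#|faces k K| <= n ^ k)%N.
Proof.
move=> Kn; apply: leq_trans (expn_leq k Kn); apply: leq_trans (bin_leq_expn _ _).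
rewrite -cards_draws; apply/subset_leq_card/fintype.subsetP => s.
by rewrite !inE => /andP[sK ->]; rewrite andbT; exact: bigcup_sup sK.
Qed.

(** Turns the size of a common link into a count of pairs (A, t), which can also be summed over
    t. *)
Lemma faces_common_link (V : finType) (A : {set V}) (K : {set {set V}}) (k : nat) :
  faces k (common_link A K) = [set t in faces k K | A \subset extensions K t].
Proof.
apply/setP => t; rewrite !inE -!andbA; case: (t \in K) => //=.
rewrite [RHS]andbC andbA; congr (_ && _).
apply/andP/fintype.subsetP => [[dAt /forallP At] v vA|h].
  by rewrite inE (disjointFr dAt vA); have := At v; rewrite vA.
split; last by apply/forallP => v; apply/implyP => /h; rewrite inE => /andP[].
by rewrite disjoint_subset; apply/fintype.subsetP => v /h; rewrite !inE => /andP[].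
Qed.

(** Count pairs of a k-face t and an r-set A of extensions of t. Summed over A they are bounded
    above by the largest link; summed over t, convexity bounds them below in terms of the total
    degree. *)
Lemma common_link_leq (V : finType) (K : {set {set V}}) (n k r : nat) :
  (0 < r)%N -> down_closed K -> (#|cover K| <= n)%N ->
  ((#|faces k.+1 K| - r * n ^ k) ^ r <= n ^ (k * r.-1) * n ^ r *
    \max_(A : {set V} | (A \subset cover K) && (#|A| == r))
        #|faces k (common_link A K)|)%N.
Proof.
move=> r0 dK Kn; set h := (\max_(A | _) _)%N.
(* Degrees are lowered by r so that their r-th powers stay below falling factorials; over at most
   [n ^ k] faces this costs [r * n ^ k]. *)
set T := faces k K; pose a t := (#|extensions K t| - r)%N.
have lkK t : extensions K t \subset cover K.
  apply/fintype.subsetP => v; rewrite inE => /andP[_ vK].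
  by apply/bigcupP; exists (v |: t); rewrite // !inE eqxx.
have x_a : (#|faces k.+1 K| - r * n ^ k <= \sum_(t in T) a t)%N.
  rewrite leq_subLR; apply: leq_trans (card_faces_leq _ dK) _.
  apply: (@leq_trans (r * #|T| + \sum_(t in T) a t)%N).
    rewrite mulnC -sum_nat_const -big_split /=; apply: leq_sum => t _.
    by rewrite /a -leq_subLR.
  by rewrite leq_add2r leq_mul2l card_faces_expn ?orbT.
have a_h : (\sum_(t in T) a t ^ r <= n ^ r * h)%N.
  apply: (@leq_trans (\sum_(t in T) 'C(#|extensions K t|, r) * r`!)%N).
    by apply: leq_sum => t _; rewrite bin_ffact expn_leq_ffact.
  rewrite -big_distrl /=.
  apply: (@leq_trans ('C(n, r) * h * r`!)%N); last first.
    by rewrite mulnAC bin_ffact leq_mul2r ffact_leq_expn orbT.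
  rewrite leq_mul2r; apply/orP; right.
  apply: (@leq_trans ('C(#|cover K|, r) * h)%N); last first.
    by rewrite leq_mul2r leq_bin2l // orbT.
  rewrite -cards_draws -sum_nat_const.
  rewrite (eq_bigr (fun t => \sum_(A : {set V} |
      [&& A \subset cover K, #|A| == r & A \subset extensions K t]) 1)%N); last first.
    move=> t _; rewrite -cards_draws -sum1_card; apply: eq_bigl => A; rewrite inE.
    rewrite andbA [RHS]andbC; case At : (A \subset _) => //=.
    by rewrite (fintype.subset_trans At (lkK t)).
  rewrite (exchange_big_dep (fun A : {set V} => (A \subset cover K) && (#|A| == r))) /=; last first.
    by move=> t A _ /and3P[-> ->].
  rewrite [leqRHS](eq_bigl (fun A : {set V} => (A \subset cover K) && (#|A| == r))); last first.
    by move=> A; rewrite inE.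
  apply: leq_sum => A AP.
  apply: leq_trans (leq_bigmax_cond A AP); rewrite faces_common_link -[leqRHS]sum1_card.
  rewrite [leqRHS](eq_bigl (fun t => (t \in T) && (A \subset extensions K t))); last first.
    by move=> t; rewrite inE.
  apply: eq_leq; apply: eq_bigl => t; case/andP: AP => -> -> //.
apply: leq_trans (expn_leq r x_a) _; rewrite -mulnA.
case: r r0 @h @a x_a a_h => // r _ h a _ a_h.
apply: leq_trans (expn_sum_leq _ _ _) _; rewrite leq_mul //= expnM expn_leq //.
exact: card_faces_expn.
Qed.

(** Subdivision vertices are confined to [cover K], so that a set disjoint from this cover can still
    be joined on. *)
Definition contains_subdivided_join (V : finType) (k r : nat) (K : {set {set V}}) : Prop :=
  exists As G, [/\ size As = k, pairwise_disjoint As,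
    forall A, A \in As -> A \subset cover K /\ #|A| = r,
    subdiv (cover K) (discrete_join As) G & G \subset K].

(** The density demanded by [mader] for K_{r,r}, that is 2^(r^2) (2 r + 1). *)
Definition mader_constant (r : nat) : nat :=
  (2 ^ size (bipartite_edges r) * #|((bool * 'I_r)%type : finType)|.+1)%N.

Lemma mader_constant_gt0 (r : nat) : (0 < mader_constant r)%N.
Proof. by rewrite muln_gt0 expn_gt0. Qed.

Lemma contains_subdivided_bipartite (V : finType) (r n : nat) (K : {set {set V}}) :
  down_closed K -> (#|cover K| <= n)%N -> (0 < n)%N ->
  (mader_constant r * n <= #|faces 2 K|)%N ->
  contains_subdivided_join 2 r K.
Proof.
move=> dK Kn n0 KD.
pose e : rel V := [rel x y | (x != y) && ([set x; y] \in K)].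
have es : symmetric e by move=> x y; rewrite /e /= eq_sym setUC.
have ei : irreflexive e by move=> x; rewrite /e /= eqxx.
have [s sK] : exists s, s \in faces 2 K.
  apply/set0Pn; rewrite -card_gt0; apply: leq_trans KD.
  by rewrite muln_gt0 mader_constant_gt0.
have coverP s' x : s' \in K -> x \in s' -> x \in cover K.
  by move=> s'K xs'; apply/bigcupP; exists s'.
have W0 : cover K != set0.
  move: sK; rewrite inE => /andP[sK s2].
  have /set0Pn[x xs] : s != set0 by rewrite -card_gt0 (eqP s2).
  by apply/set0Pn; exists x; exact: coverP xs.
have KW : (mader_constant r * #|cover K| <= degree_sum e (cover K))%N.
  apply: (@leq_trans (mader_constant r * n)%N); first by rewrite leq_mul2l Kn orbT.
  apply: leq_trans KD _; apply: (@leq_trans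
    #|\bigcup_(x in cover K) (fun y => [set x; y]) @: [set y in cover K | e x y]|).
    apply/subset_leq_card/fintype.subsetP => t; rewrite inE => /andP[tK /cards2P[x [y [xy tE]]]].
    have xt : x \in t by rewrite tE !inE eqxx.
    have yt : y \in t by rewrite tE !inE eqxx orbT.
    apply/bigcupP; exists x; first exact: coverP xt.
    apply/imsetP; exists y => //; rewrite inE (coverP _ _ tK yt) /=.
    by rewrite /e /= xy -tE.
  apply: leq_trans (card_bigcup_leq _ _) _; apply: leq_sum => x _.
  exact: leq_imset_card.
have neq : all (fun p : (bool * 'I_r) * (bool * 'I_r) => p.1 != p.2) (bipartite_edges r).
  by apply/allP => p /allpairsP[[i j] /= [_ _ ->]].
have [b bI [bW [G SG GK]]] := mader neq es ei W0 KW.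
have [FE dB] := edge_family_bipartite bI; rewrite FE in SG.
eexists; exists G; split; [| exact: dB | | exact: SG |].
- by [].
- have BP c : [set b (c, i) | i in 'I_r] \subset cover K /\ #|[set b (c, i) | i in 'I_r]| = r.
    split; first by apply/fintype.subsetP => x /imsetP[i _ ->].
    by rewrite card_imset ?card_ord // => i j /bI [].
  by move=> A; rewrite !inE => /orP[/eqP->|/eqP->].
apply/fintype.subsetP => t /(fintype.subsetP GK); rewrite inE.
case/or3P => [/eqP->|/existsP[x /andP[/bigcupP[s' s'K xs'] /eqP->]]|].
- by move: sK; rewrite inE => /andP[/dK + _]; apply; exact: sub0set.
- by apply: dK s'K _; rewrite sub1set.
by case/existsP => x /andP[_ /existsP[y /and3P[_ /andP[_ xyK] /eqP->]]].
Qed.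

(** The cover of the common link misses A, hence so do all subdivision vertices, and joining with A
    respects the subdivision. The result lies in K because a face of the link can be extended by any
    one vertex of A. *)
Lemma contains_subdivided_djoin (V : finType) (k r : nat) (A : {set V})
    (K : {set {set V}}) :
  down_closed K -> A \subset cover K -> #|A| = r -> (0 < r)%N ->
  contains_subdivided_join k r (common_link A K) ->
  contains_subdivided_join k.+1 r K.
Proof.
move=> dK AK Ar r0 [As [G [kAs dAs AsP SG GK]]].
have KK : cover (common_link A K) \subset cover K.
  apply/bigcupsP => s; rewrite inE => /andP[sK _]; exact: bigcup_sup sK.
have AL : [disjoint A & cover (common_link A K)].
  rewrite disjoint_sym disjoints_subset; apply/bigcupsP => s; rewrite inE.
  by case/and3P=> _ + _; rewrite disjoint_sym disjoints_subset.
exists (A :: As), (djoin A G); split.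
- by rewrite /= kAs.
- rewrite /pairwise_disjoint /= -/(pairwise_disjoint As) dAs andbT; apply/allP => B /AsP[BK _].
  exact: disjointWr BK AL.
- move=> B; rewrite inE => /orP[/eqP->//|/AsP[BK ->]]; split=> //.
  exact: fintype.subset_trans BK KK.
- by apply: subdivS KK _; exact: subdiv_djoin.
apply/fintype.subsetP => s; rewrite inE => /andP[/set_card_le1 sA /(fintype.subsetP GK)].
rewrite inE => /and3P[sK _ /forallP lk].
case: sA => [sA|[v sA]]; first by rewrite -(setID s A) sA set0U.
have vA : v \in A by have : v \in s :&: A by [rewrite sA inE]; case/setIP.
by have := lk v; rewrite vA /= -sA setID.
Qed.

(** Because s <= n, the loss [r * n ^ k] costs only r in the constant. Taking r-th powers and
    cancelling powers of n turns s into s^r; the constant survives as c <= c^r. *)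
Lemma exists_dense_common_link (R : realType) (V : finType) (r k c n : nat) (s : R)
    (K : {set {set V}}) :
  (0 < r)%N -> (0 < c)%N -> (0 < n)%N -> down_closed K -> (#|cover K| <= n)%N ->
  0 < s -> s <= n%:R ->
  (c + r)%:R * n%:R ^+ k.+1 <= #|faces k.+1 K|%:R * s ->
  exists A : {set V}, [/\ A \subset cover K, #|A| = r &
    c%:R * n%:R ^+ k <= #|faces k (common_link A K)|%:R * s ^+ r].
Proof.
move=> r0 c0 n0 dK Kn s0 sn Kx.
have N0 : 0 < n%:R :> R by rewrite ltr0n.
have := common_link_leq k r0 dK Kn.
set P := (fun A : {set V} => (A \subset cover K) && (#|A| == r)).
set h := (\max_(A | _) _)%N => hx.
set x := #|faces k.+1 K| in hx Kx; set y := (x - r * n ^ k)%N in hx.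
have yx : x%:R - r%:R * n%:R ^+ k <= y%:R :> R.
  by rewrite lerBlDr -natrX -natrM -natrD ler_nat addnC -leq_subLR.
have ys : c%:R * n%:R ^+ k.+1 <= y%:R * s.
  apply: le_trans (ler_wpM2r (ltW s0) yx); rewrite mulrBl lerBrDr.
  apply: le_trans Kx; rewrite natrD mulrDl lerD2l -mulrA ler_wpM2l ?ler0n //.
  by rewrite exprSr ler_wpM2l // exprn_ge0 // ltW.
have hs : c%:R * n%:R ^+ k <= h%:R * s ^+ r.
  have cN0 : 0 <= c%:R * n%:R ^+ k.+1 :> R by rewrite mulr_ge0 ?ler0n // exprn_ge0 // ltW.
  have M0 : 0 < n%:R ^+ (k * r.-1) * n%:R ^+ r :> R by rewrite mulr_gt0 // exprn_gt0.
  rewrite -(ler_pM2l M0); apply: (@le_trans _ _ ((c%:R * n%:R ^+ k.+1) ^+ r)).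
    rewrite exprMn -exprM mulrCA -!exprD.
    have -> : (k.+1 * r = k * r.-1 + r + k)%N by rewrite mulSn -{1 2}(prednK r0) mulnS; lia.
    apply: ler_wpM2r; first by rewrite exprn_ge0 // ltW.
    by rewrite -natrX ler_nat -{1}(expn1 c) leq_pexp2l.
  apply: (@le_trans _ _ ((y%:R * s) ^+ r)).
    by rewrite lerXn2r // nnegrE // (le_trans cN0).
  rewrite exprMn mulrA ler_wpM2r ?exprn_ge0 ?(ltW s0) //.
  by rewrite -!natrX -!natrM ler_nat.
(* A maximum over no sets would be 0, so positivity of h provides an admissible A attaining it. *)
have h0 : (0 < h)%N.
  rewrite lt0n; apply: contraTneq hs => ->; rewrite mul0r -ltNge.
  by rewrite mulr_gt0 ?ltr0n // exprn_gt0.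
have P0 : (0 < #|P|)%N.
  rewrite lt0n; apply: contraTneq h0 => /card0_eq P0.
  by rewrite /h big_pred0 //.
have [A PA hA] := eq_bigmax_cond (fun A => #|faces k (common_link A K)|) P0.
have /andP[AK /eqP Ar] : P A by exact: PA.
by exists A; split=> //; rewrite -hA.
Qed.

(* The real number s stands for n^e, where e is the exponent deficit. *)
Lemma contains_subdivided_join_of_dense (R : realType) (r : nat) : (0 < r)%N ->
  forall (j : nat) (V : finType) (K : {set {set V}}) (n : nat) (s : R),
  down_closed K -> (#|cover K| <= n)%N -> (0 < n)%N ->
  1 <= s -> s ^+ (r ^ j) <= n%:R ->
  (mader_constant r + j * r)%:R * n%:R ^+ j.+2 <= #|faces j.+2 K|%:R * s ->
  contains_subdivided_join j.+2 r K.
Proof.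
move=> r0; elim=> [|j IH] V K n s dK Kn n0 s1 sn Kx.
  (* Now s <= n, so cancelling one factor n leaves the linear edge bound needed for Mader's
     theorem. *)
  apply: (contains_subdivided_bipartite dK Kn n0).
  have N0 : 0 < n%:R :> R by rewrite ltr0n.
  rewrite -(ler_nat R) natrM -(ler_pM2r N0) -mulrA -expr2.
  rewrite addn0 in Kx; apply: le_trans Kx _.
  by rewrite ler_wpM2l ?ler0n.
have s0 : 0 < s := lt_le_trans ltr01 s1.
have sn1 : s <= n%:R.
  by apply: le_trans sn; rewrite -[leLHS]expr1 ler_weXn2l // expn_gt0 r0.
rewrite mulSn addnCA addnC in Kx.
have [|A [AK Ar Ax]] := exists_dense_common_link r0 _ n0 dK Kn s0 sn1 Kx.
  by rewrite addn_gt0 mader_constant_gt0.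
apply: (contains_subdivided_djoin dK AK Ar r0).
apply: (IH _ _ n (s ^+ r)) => //.
- exact: common_link_down_closed.
- apply: leq_trans Kn; apply/subset_leq_card/bigcupsP => t; rewrite inE => /andP[tK _].
  exact: bigcup_sup tK.
- exact: exprn_ege1.
- by rewrite -exprM -expnS.
Qed.

Theorem theorem5 (R : realType) (d r : nat) (hd : (1 <= d)%N) (hr : (1 <= r)%N) :
  exists C : R, forall n : nat, (1 <= n)%N ->
    forall (V : finType) (K : {set {set V}}),
      simplicial_complex K -> has_dim d K -> #|vertices K| = n ->
      ~ (exists L : {set {set V}}, subcomplex L K /\
           homeomorphic (realization_space R L)
                        (realization_space R (join_power d.+1 r))) ->
      (#|simplices_of_dim d K|%:R : R)
        < C * n%:R `^ (d.+1%:R - r%:R `^ (1 - d%:R)).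
Proof.
(* With d = j + 1 there are j link steps before a graph is reached, each costing r. *)
case: d hd => // j _; exists (mader_constant r + j * r)%:R.
move=> n n0 V K [K0 dK] _ Kn noL; rewrite ltNge; apply/negP => Kx; apply: noL.
have N0 : 0 < n%:R :> R by rewrite ltr0n.
have r0 : 0 < r%:R :> R by rewrite ltr0n.
pose K1 := set0 |: K.
have dK1 : down_closed K1.
  move=> s t; rewrite !inE; case: (eqVneq t set0) => //= t0.
  case/orP => [/eqP ->|sK ts]; first by rewrite subset0 (negPf t0).
  exact: dK sK ts t0.
have K1n : (#|cover K1| <= n)%N.
  rewrite -Kn; apply/subset_leq_card/bigcupsP => s /setU1P[->|sK]; first exact: sub0set.
  apply/fintype.subsetP => v vs; rewrite inE; apply: dK sK _ _; first by rewrite sub1set.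
  by apply/set0Pn; exists v; rewrite inE.
set ex := r%:R `^ (1 - j.+1%:R) in Kx.
(* This is what fixes the exponent: starting from s = n^ex, j successive r-th powers give exactly
   n. *)
have exE : ex * r%:R ^+ j = 1.
  rewrite /ex (_ : 1 - j.+1%:R = - j%:R); last by rewrite -natr1; lra.
  rewrite powRN powR_mulrn ?ltW // mulVf // expf_neq0 // gt_eqF //.
have [|||As [G [kAs dAs AsP SG GK]]] := @contains_subdivided_join_of_dense R r hr j V K1 n
  (n%:R `^ ex) dK1 K1n n0.
- by rewrite -[leLHS](powRr0 n%:R) ler_powR ?ler1n // powR_ge0.
- by rewrite -powR_mulrn ?powR_ge0 // -powRrM natrX exE powRr1 // ltW.
- have -> : faces j.+2 K1 = simplices_of_dim j.+1 K.
    apply/setP => s; rewrite !inE; have [->|//] := eqVneq s set0.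
    by rewrite cards0 !andbF.
  (* Multiplying the assumed lower bound by n^ex leaves the integral power n^(d + 1). *)
  apply: le_trans (ler_wpM2r (powR_ge0 _ _) Kx); rewrite -mulrA -powRD; last first.
    by rewrite (gt_eqF N0) implybT.
  by rewrite subrK powR_mulrn // ltW.
have dG : down_closed G := subdiv_down_closed (@discrete_join_down_closed _ _) SG.
exists (G :\ set0); split.
  split.
    split; first by rewrite !inE eqxx.
    by move=> s t /setD1P[_ sG] ts t0; apply/setD1P; split=> //; exact: dG sG ts.
  apply/fintype.subsetP => s /setD1P[s0 /(fintype.subsetP GK)].
  by rewrite in_setU1 (negPf s0).
rewrite -kAs /realization_space realizationD0.
apply: (homeomorphic_trans (homeomorphic_sym (subdiv_homeomorphic R SG))).
apply: homeomorphic_discrete_join => //; first by rewrite kAs.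
by move=> A /AsP[].
Qed.
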